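(* Let $\lambda\in\mathbb{R}$ and let $\gamma:[a,b]\to\mathbb{H}^2_+$ be a smooth regular curve along which $d+\lambda\neq0$. Then $\gamma$ is a hyperbolic catenary (with parameter $\lambda$) if and only if its curvature $\kappa_h$ in $\mathbb{H}^2$ satisfies $$\kappa_h=\frac{g(\mathbf{n},Y)}{d+\lambda},$$ where $\mathbf{n}$ is the unit normal vector of $\gamma$ and $$Y(x,y)=y\left(\frac{y}{\sqrt{x^2+y^2}}\,\partial_x-\frac{x}{\sqrt{x^2+y^2}}\,\partial_y\right).$$
   Context: $\mathbb{H}^2$ is the upper half-plane $\{(x,y)\in\mathbb{R}^2:y>0\}$ with the metric $g=\frac{dx^2+dy^2}{y^2}$, and $\mathbb{H}^2_+=\{(x,y)\in\mathbb{H}^2:x>0\}$. The function $d=\log\frac{x+\sqrt{x^2+y^2}}{y}$ is, on $\mathbb{H}^2_+$, the hyperbolic distance to the geodesic $L=\{(0,y):y>0\}$. The potential energy of $\gamma=(u,v)$ is $$\mathcal{E}_H[\gamma]=\int_a^b(d+\lambda)\frac{\sqrt{u'^2+v'^2}}{v}\,dt,\qquad d=\log\frac{u+\sqrt{u^2+v^2}}{v},$$ where $\lambda\in\mathbb{R}$ is a fixed constant (a Lagrange multiplier). A hyperbolic catenary is a critical point of $\mathcal{E}_H$, i.e. a curve at which the first variation vanishes for all smooth variations in $\mathbb{H}^2_+$ with fixed endpoints (equivalently, $(u,v)$ satisfies both Euler–Lagrange equations of the integrand). With $m=u'^2+v'^2$, the unit normal is $\mathbf{n}=v\frac{(-v',u')}{\sqrt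 m}$, and $\kappa_h$ is the geodesic curvature with respect to $\mathbf{n}$; explicitly $\kappa_h=v\,\frac{u'v''-u''v'}{m^{3/2}}+\frac{u'}{\sqrt m}$. *)

(* Defs.v *)
(* Classical real analysis over Stdlib's R, with Coquelicot. *)
From Stdlib Require Export Reals.
From Coquelicot Require Export Coquelicot.
From Stdlib Require Import Lra.
Open Scope R_scope.

(* Points of the half-plane and tangent vectors (in the frame d/dx, d/dy) are
   pairs of reals.  A curve is given by its coordinate functions u, v. *)

Definition in_H2plus (p : R * R) : Prop := 0 < fst p /\ 0 < snd p.

Definition hyp_metric (p X Z : R * R) : R :=
  (fst X * fst Z + snd X * snd Z) / (snd p) ^ 2.

Definition hyp_dist_L (p : R * R) : R :=
  ln ((fst p + sqrt ((fst p) ^ 2 + (snd p) ^ 2)) / snd p).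

Definition field_Y (p : R * R) : R * R :=
  let r := sqrt ((fst p) ^ 2 + (snd p) ^ 2) in
  (snd p * (snd p / r), snd p * (- (fst p / r))).

(* A function is smooth on [a, b] when it is C^oo on some open interval
   containing [a, b]; only its values on [a, b] are relevant below, since they
   determine all the derivatives on [a, b], endpoints included. *)
Definition smooth_on_segment (a b : R) (f : R -> R) : Prop :=
  exists e : R, 0 < e /\
    forall (n : nat) (t : R), a - e < t < b + e -> ex_derive_n f n t.

Definition regular_on_segment (a b : R) (u v : R -> R) : Prop :=
  forall t : R, a <= t <= b -> ~ (Derive u t = 0 /\ Derive v t = 0).

Definition speed2 (u v : R -> R) (t : R) : R := (Derive u t) ^ 2 + (Derive v t) ^ 2.

Definition unit_normal (u v : R -> R) (t : R) : R * R :=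
  (v t * (- Derive v t / sqrt (speed2 u v t)),
   v t * (Derive u t / sqrt (speed2 u v t))).

(* Levi-Civita covariant derivative of (u', v') along the curve.  The nonzero
   Christoffel symbols of (dx^2 + dy^2) / y^2 are
   Gamma^x_xy = Gamma^x_yx = -1/y, Gamma^y_xx = 1/y, Gamma^y_yy = -1/y. *)
Definition covariant_acceleration (u v : R -> R) (t : R) : R * R :=
  (Derive_n u 2 t - 2 * (Derive u t * Derive v t) / v t,
   Derive_n v 2 t + ((Derive u t) ^ 2 - (Derive v t) ^ 2) / v t).

(* g(D_t c', n) / g(c', c'): invariant under orientation-preserving
   reparametrization, so no arc-length parameter is needed. *)
Definition geodesic_curvature (u v : R -> R) (t : R) : R :=
  let p := (u t, v t) in
  let c' := (Derive u t, Derive v t) in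
  hyp_metric p (covariant_acceleration u v t) (unit_normal u v t)
  / hyp_metric p c' c'.

Lemma geodesic_curvatureE (u v : R -> R) (t : R) :
  0 < v t -> 0 < speed2 u v t ->
  geodesic_curvature u v t =
    v t * ((Derive u t * Derive_n v 2 t - Derive_n u 2 t * Derive v t)
           / (sqrt (speed2 u v t)) ^ 3)
    + Derive u t / sqrt (speed2 u v t).
Proof.
intros hv hm.
assert (hs : 0 < sqrt (speed2 u v t)) by (apply sqrt_lt_R0; exact hm).
assert (hss : sqrt (speed2 u v t) * sqrt (speed2 u v t) = speed2 u v t)
  by (apply sqrt_sqrt; lra).
unfold geodesic_curvature, hyp_metric, unit_normal, covariant_acceleration.
cbn [fst snd].
replace (Derive u t * Derive u t + Derive v t * Derive v t)
  with (sqrt (speed2 u v t) * sqrt (speed2 u v t))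
  by (rewrite hss; unfold speed2; ring).
assert (hm2 : (Derive u t) ^ 2 + (Derive v t) ^ 2
              = sqrt (speed2 u v t) * sqrt (speed2 u v t))
  by (rewrite hss; reflexivity).
revert hs hm2. generalize (sqrt (speed2 u v t)).
intros s hs hm2.
apply Rminus_diag_uniq.
transitivity
  (Derive u t * ((Derive u t) ^ 2 + (Derive v t) ^ 2 - s * s) / s ^ 3).
- field; split; lra.
- rewrite hm2. field; lra.
Qed.

Definition potential_energy (lam a b : R) (u v : R -> R) : R :=
  RInt (fun t => (hyp_dist_L (u t, v t) + lam) * (sqrt (speed2 u v t) / v t)) a b.

(* (U s, V s) is the curve of parameter s.  As for curves, smoothness on
   (-e, e) x [a, b] means smoothness on an open neighbourhood; [ex_diff_n f n]
   asks for all iterated partial derivatives up to order n, with continuity. *)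
Definition smooth_variation (a b : R) (u v : R -> R) (U V : R -> R -> R) : Prop :=
  exists e : R, 0 < e /\
    (forall (n : nat) (s t : R), - e < s < e -> a - e < t < b + e ->
       ex_diff_n U n s t /\ ex_diff_n V n s t) /\
    (forall s t : R, - e < s < e -> a <= t <= b -> in_H2plus (U s t, V s t)) /\
    (forall t : R, a <= t <= b -> U 0 t = u t /\ V 0 t = v t) /\
    (forall s : R, - e < s < e ->
       (U s a = u a /\ V s a = v a) /\ (U s b = u b /\ V s b = v b)).

Definition hyperbolic_catenary (lam a b : R) (u v : R -> R) : Prop :=
  forall U V : R -> R -> R, smooth_variation a b u v U V ->
    is_derive (fun s : R => potential_energy lam a b (U s) (V s)) 0 0.

(* Main.v *)
(* The integrand [F (u, v, u', v')] of the energy is positively homogeneous of degree 1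
   in the velocity, so its two Euler-Lagrange expressions are not independent: with
   [W = (d + lam) kappa_h - g (n, Y)] ([catenary_defect] below)
   they are [v' W / v^2] and [- u' W / v^2].
   Differentiating under the integral sign and integrating by parts, the first
   variation in the direction [(xi, eta)] is the integral of
   [(v' xi - u' eta) W / v^2].  It vanishes if [W = 0]; conversely, the direction
   [(v', - u') (W / v^2) (t - a) (b - t)] is itself smooth and gives the integral of
   [(u'^2 + v'^2) (W / v^2)^2 (t - a) (b - t)], which forces [W = 0]. *)

Require Import Defs.
From Stdlib Require Import Lra.
Open Scope R_scope.

(** * Functions of class C^k on an open set of reals *)

(** The recursion passes to the total function [Derive f], so closure under the operations goes by
    induction on the order. Continuity is asked only of the last derivative, the earlier ones being
    differentiable. *)
Fixpoint Ck_on (D : R -> Prop) (n : nat) (f : R -> R) : Prop :=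
  match n with
  | O => forall t, D t -> continuous f t
  | S k => (forall t, D t -> ex_derive f t) /\ Ck_on D k (Derive f)
  end.

Lemma Ck_on_subset (D E : R -> Prop) (n : nat) (f : R -> R) :
  (forall t, E t -> D t) -> Ck_on D n f -> Ck_on E n f.
Proof.
intros hED; revert f; induction n as [|n IH]; intros f; cbn [Ck_on].
- intros h t ht; auto.
- intros [h1 h2]; split; [intros t ht; auto | auto].
Qed.

Lemma Ck_on_continuous (D : R -> Prop) (n : nat) (f : R -> R) (t : R) :
  Ck_on D n f -> D t -> continuous f t.
Proof.
destruct n as [|n]; cbn [Ck_on].
- auto.
- intros [h _] ht; apply (ex_derive_continuous f); auto.
Qed.

Lemma Ck_on_le (D : R -> Prop) (n : nat) (f : R -> R) :
  Ck_on D (S n) f -> Ck_on D n f.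
Proof.
revert f; induction n as [|n IH]; intros f h.
- intros t; exact (Ck_on_continuous D 1 f t h).
- destruct h as [h1 h2]; split; auto.
Qed.

(** Openness of [D] turns agreement on [D] into agreement near each of its points, so the
    derivatives agree on [D] as well. *)
Lemma Ck_on_ext (D : R -> Prop) (n : nat) (f g : R -> R) :
  open D -> (forall t, D t -> f t = g t) -> Ck_on D n f -> Ck_on D n g.
Proof.
intros hD; revert f g; induction n as [|n IH]; intros f g hfg; cbn [Ck_on].
- intros h t ht; apply continuous_ext_loc with f; auto.
  generalize (hD t ht); apply filter_imp; auto.
- intros [h1 h2]; split.
  + intros t ht; apply ex_derive_ext_loc with f; auto.
    generalize (hD t ht); apply filter_imp; auto.
  + apply IH with (Derive f); auto.
    intros t ht; apply Derive_ext_loc.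
    generalize (hD t ht); apply filter_imp; auto.
Qed.

Lemma Ck_on_is_derive (D : R -> Prop) (n : nat) (f df : R -> R) :
  open D -> (forall t, D t -> is_derive f t (df t)) -> Ck_on D n df ->
  Ck_on D (S n) f.
Proof.
intros hD hf hdf; split.
- intros t ht; exists (df t); auto.
- apply Ck_on_ext with df; auto.
  intros t ht; symmetry; apply is_derive_unique; auto.
Qed.

Lemma Ck_on_const (D : R -> Prop) (n : nat) (c : R) :
  open D -> Ck_on D n (fun _ => c).
Proof.
intros hD; revert c; induction n as [|n IH]; intros c.
- intros t _; apply continuous_const.
- apply Ck_on_is_derive with (fun _ => 0); auto.
  intros t _; apply (is_derive_const c t).
Qed.

Lemma Ck_on_id (D : R -> Prop) (n : nat) :
  open D -> Ck_on D n (fun t => t).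
Proof.
intros hD; destruct n as [|n].
- intros t _; apply continuous_id.
- apply Ck_on_is_derive with (fun _ => 1); auto.
  + intros t _; apply (is_derive_id t).
  + apply Ck_on_const; auto.
Qed.

Lemma Ck_on_plus (D : R -> Prop) (n : nat) (f g : R -> R) :
  open D -> Ck_on D n f -> Ck_on D n g -> Ck_on D n (fun t => f t + g t).
Proof.
intros hD; revert f g; induction n as [|n IH]; intros f g.
- intros hf hg t ht; apply (continuous_plus f g); auto.
- intros [hf1 hf2] [hg1 hg2].
  apply Ck_on_is_derive with (fun t => Derive f t + Derive g t); auto.
  intros t ht; apply (is_derive_plus f g); apply Derive_correct; auto.
Qed.

Lemma Ck_on_mult (D : R -> Prop) (n : nat) (f g : R -> R) :
  open D -> Ck_on D n f -> Ck_on D n g -> Ck_on D n (fun t => f t * g t).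
Proof.
intros hD; revert f g; induction n as [|n IH]; intros f g hf hg.
- intros t ht; apply (continuous_mult f g); auto.
- assert (hf' := Ck_on_le _ _ _ hf); assert (hg' := Ck_on_le _ _ _ hg).
  destruct hf as [hf1 hf2]; destruct hg as [hg1 hg2].
  apply Ck_on_is_derive with (fun t => Derive f t * g t + f t * Derive g t); auto.
  + intros t ht; apply (is_derive_mult f g); auto using Derive_correct, Rmult_comm.
  + apply Ck_on_plus; auto.
Qed.

Lemma Ck_on_opp (D : R -> Prop) (n : nat) (f : R -> R) :
  open D -> Ck_on D n f -> Ck_on D n (fun t => - f t).
Proof.
intros hD hf; apply Ck_on_ext with (fun t => -1 * f t); auto.
- intros t _; ring.
- apply Ck_on_mult; auto; apply Ck_on_const; auto.
Qed.

Lemma Ck_on_minus (D : R -> Prop) (n : nat) (f g : R -> R) :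
  open D -> Ck_on D n f -> Ck_on D n g -> Ck_on D n (fun t => f t - g t).
Proof.
intros hD hf hg; apply Ck_on_plus; auto; apply Ck_on_opp; auto.
Qed.

Lemma Ck_on_pow (D : R -> Prop) (n : nat) (f : R -> R) (k : nat) :
  open D -> Ck_on D n f -> Ck_on D n (fun t => f t ^ k).
Proof.
intros hD hf; induction k as [|k IH]; cbn [pow].
- apply Ck_on_const; auto.
- apply Ck_on_mult; auto.
Qed.

(** The derivative is polynomial in [f'] and [1 / f], so the induction hypothesis for [1 / f] at the
    lower order covers it. *)
Lemma Ck_on_inv (D : R -> Prop) (n : nat) (f : R -> R) :
  open D -> (forall t, D t -> f t <> 0) -> Ck_on D n f ->
  Ck_on D n (fun t => / f t).
Proof.
intros hD hf0; induction n as [|n IH]; intros hf.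
- intros t ht; apply continuous_Rinv_comp; auto.
- assert (hf' := IH (Ck_on_le _ _ _ hf)); destruct hf as [hf1 hf2].
  apply Ck_on_is_derive with (fun t => - (Derive f t * (/ f t) ^ 2)); auto.
  + intros t ht.
    replace (- (Derive f t * (/ f t) ^ 2)) with (- Derive f t / f t ^ 2)
      by (field; auto).
    apply is_derive_inv; auto using Derive_correct.
  + apply Ck_on_opp; auto; apply Ck_on_mult; auto; apply Ck_on_pow; auto.
Qed.

Lemma Ck_on_div (D : R -> Prop) (n : nat) (f g : R -> R) :
  open D -> (forall t, D t -> g t <> 0) -> Ck_on D n f -> Ck_on D n g ->
  Ck_on D n (fun t => f t / g t).
Proof.
intros hD hg0 hf hg; apply Ck_on_mult; auto; apply Ck_on_inv; auto.
Qed.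

Lemma Ck_on_sqrt (D : R -> Prop) (n : nat) (f : R -> R) :
  open D -> (forall t, D t -> 0 < f t) -> Ck_on D n f ->
  Ck_on D n (fun t => sqrt (f t)).
Proof.
intros hD hf0; induction n as [|n IH]; intros hf.
- intros t ht; apply continuous_sqrt_comp; auto.
- assert (hf' := IH (Ck_on_le _ _ _ hf)); destruct hf as [hf1 hf2].
  apply Ck_on_is_derive with (fun t => Derive f t / (2 * sqrt (f t))); auto.
  + intros t ht; apply is_derive_sqrt; auto using Derive_correct.
  + apply Ck_on_div; auto.
    * intros t ht; generalize (sqrt_lt_R0 _ (hf0 t ht)); lra.
    * apply Ck_on_mult; auto; apply Ck_on_const; auto.
Qed.

Lemma Ck_on_ln (D : R -> Prop) (n : nat) (f : R -> R) :
  open D -> (forall t, D t -> 0 < f t) -> Ck_on D n f ->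
  Ck_on D n (fun t => ln (f t)).
Proof.
intros hD hf0 hf; destruct n as [|n].
- intros t ht; apply (continuous_comp f ln); auto; apply continuous_ln; auto.
- assert (hf' := Ck_on_le _ _ _ hf); destruct hf as [hf1 hf2].
  apply Ck_on_is_derive with (fun t => Derive f t / f t); auto.
  + intros t ht; apply (is_derive_comp ln f); auto using Derive_correct, is_derive_ln.
  + apply Ck_on_div; auto.
    intros t ht; generalize (hf0 t ht); lra.
Qed.

(** Each derivative is continuous because the next one exists. All [k] are treated at once since the
    induction on [n] moves from order [k] to order [k + 1]. *)
Lemma Ck_on_Derive_n (D : R -> Prop) (f : R -> R) :
  (forall n t, D t -> ex_derive_n f n t) -> forall n k, Ck_on D n (Derive_n f k).
Proof.
intros hf n; induction n as [|n IH]; intros k.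
- intros t ht; apply (ex_derive_continuous (Derive_n f k)); apply (hf (S k) t ht).
- split; [intros t ht; apply (hf (S k) t ht) | apply (IH (S k))].
Qed.

(** * Joint smoothness of families affine in the parameter *)

Lemma continuity_2d_pt_snd (h : R -> R) (s t : R) :
  continuous h t -> continuity_2d_pt (fun _ y => h y) s t.
Proof.
intros hh; apply (continuity_1d_2d_pt_comp h (fun _ y => y)).
- apply continuity_pt_filterlim; exact hh.
- apply continuity_2d_pt_id2.
Qed.

(* The [s]-derivative of [f t + s * g t] is [g t + s * 0], again of the same form. *)
Lemma ex_diff_n_affine (D : R -> Prop) (n : nat) (f g : R -> R) (s t : R) :
  open D -> Ck_on D n f -> Ck_on D n g -> D t ->
  ex_diff_n (fun s t => f t + s * g t) n s t.
Proof.
intros hD; revert f g s t; induction n as [|n IH]; intros f g s t hf hg ht.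
all: assert (hc : continuity_2d_pt (fun s t => f t + s * g t) s t)
  by (apply continuity_2d_pt_plus; [|apply continuity_2d_pt_mult];
      try apply continuity_2d_pt_id1;
      apply continuity_2d_pt_snd; eapply Ck_on_continuous; eauto).
- split; auto.
- assert (hg' := Ck_on_le _ _ _ hg).
  destruct hf as [hf1 hf2]; destruct hg as [hg1 hg2].
  split; [exact hc | split; [|split; [|split]]].
  + auto_derive; auto.
  + auto_derive; auto.
  + apply ex_diff_n_ext_loc with (fun s t => g t + s * 0).
    * exists (mkposreal 1 Rlt_0_1); intros x y _ _; symmetry.
      apply is_derive_unique; auto_derive; auto; ring.
    * apply (IH g (fun _ => 0)); auto; apply Ck_on_const; auto.
  + apply ex_diff_n_ext_loc with (fun s t => Derive f t + s * Derive g t).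
    * destruct (hD t ht) as [d hd].
      exists d; intros x y _ hy; symmetry.
      assert (hy' : D y) by (apply hd; exact hy).
      apply is_derive_unique; auto_derive; auto.
      change (fun x0 => f x0) with f; change (fun x0 => g x0) with g; ring.
    * apply IH; auto.
Qed.

(** * The integrand and its Euler-Lagrange expressions *)

(** The integrand of the energy, with position [(x, y)] and velocity [(p, q)] as independent
    variables. The next four definitions are its partial derivatives; the first two rest on
    [d_x = 1 / r] and [d_y = - x / (y r)], where [r = sqrt (x^2 + y^2)]. *)
Definition lagrangian (lam x y p q : R) : R :=
  (hyp_dist_L (x, y) + lam) * (sqrt (p ^ 2 + q ^ 2) / y).

Definition lagrangian_x (x y p q : R) : R :=
  sqrt (p ^ 2 + q ^ 2) / (y * sqrt (x ^ 2 + y ^ 2)).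

Definition lagrangian_y (lam x y p q : R) : R :=
  - (x / sqrt (x ^ 2 + y ^ 2) + (hyp_dist_L (x, y) + lam)) / y ^ 2
  * sqrt (p ^ 2 + q ^ 2).

Definition lagrangian_p (lam x y p q : R) : R :=
  (hyp_dist_L (x, y) + lam) / y * (p / sqrt (p ^ 2 + q ^ 2)).

Definition lagrangian_q (lam x y p q : R) : R :=
  (hyp_dist_L (x, y) + lam) / y * (q / sqrt (p ^ 2 + q ^ 2)).

Lemma is_derive_eq (f : R -> R) (x l l' : R) :
  is_derive f x l -> l = l' -> is_derive f x l'.
Proof. intros h <-; exact h. Qed.

Lemma sqrt_sum_sqr_pos (x y : R) :
  0 < x ^ 2 + y ^ 2 ->
  0 < sqrt (x ^ 2 + y ^ 2) /\ sqrt (x ^ 2 + y ^ 2) ^ 2 = x ^ 2 + y ^ 2.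
Proof.
intros h; split; [apply sqrt_lt_R0; exact h | apply pow2_sqrt; lra].
Qed.

Lemma is_derive_sqrt_sum_sqr (x y : R -> R) (dx dy s : R) :
  0 < x s ^ 2 + y s ^ 2 -> is_derive x s dx -> is_derive y s dy ->
  is_derive (fun t => sqrt (x t ^ 2 + y t ^ 2)) s
    ((x s * dx + y s * dy) / sqrt (x s ^ 2 + y s ^ 2)).
Proof.
intros hm hdx hdy; destruct (sqrt_sum_sqr_pos _ _ hm) as [hr _].
replace ((x s * dx + y s * dy) / sqrt (x s ^ 2 + y s ^ 2))
  with ((INR 2 * dx * x s ^ Nat.pred 2 + INR 2 * dy * y s ^ Nat.pred 2)
        / (2 * sqrt (x s ^ 2 + y s ^ 2))) by (simpl; field; simpl in hr; lra).
apply (is_derive_sqrt (fun t => x t ^ 2 + y t ^ 2)); [|exact hm].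
apply (is_derive_plus (fun t => x t ^ 2) (fun t => y t ^ 2));
  apply is_derive_pow; auto.
Qed.

Lemma is_derive_hyp_dist_L (x y : R -> R) (dx dy s : R) :
  0 < x s -> 0 < y s -> is_derive x s dx -> is_derive y s dy ->
  is_derive (fun t => hyp_dist_L (x t, y t)) s
    ((y s * dx - x s * dy) / (y s * sqrt (x s ^ 2 + y s ^ 2))).
Proof.
intros hx hy hdx hdy.
assert (hm : 0 < x s ^ 2 + y s ^ 2) by nra.
destruct (sqrt_sum_sqr_pos _ _ hm) as [hr hrr].
unfold hyp_dist_L; cbn [fst snd].
assert (hpos : 0 < (x s + sqrt (x s ^ 2 + y s ^ 2)) / y s)
  by (apply Rdiv_lt_0_compat; lra).
assert (hq : is_derive (fun t => (x t + sqrt (x t ^ 2 + y t ^ 2)) / y t) s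
  (((dx + (x s * dx + y s * dy) / sqrt (x s ^ 2 + y s ^ 2)) * y s
    - (x s + sqrt (x s ^ 2 + y s ^ 2)) * dy) / y s ^ 2)).
{ apply (is_derive_div (fun t => x t + sqrt (x t ^ 2 + y t ^ 2)) y);
    [| exact hdy | lra].
  apply (is_derive_plus x (fun t => sqrt (x t ^ 2 + y t ^ 2))); auto.
  apply is_derive_sqrt_sum_sqr; auto. }
apply (is_derive_eq _ _ _ _ (is_derive_comp ln _ s _ _ (is_derive_ln _ hpos) hq)).
unfold scal; cbn -[pow sqrt]; unfold mult; cbn -[pow sqrt].
revert hr hrr; generalize (sqrt (x s ^ 2 + y s ^ 2)); intros r hr hrr.
(* [field] treats [r] as a free variable, so the difference of the two sides is displayed as a
   multiple of [x^2 + y^2 - r^2]. *)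
apply Rminus_diag_uniq.
transitivity (dy * (y s ^ 2 + x s ^ 2 - r ^ 2) / (y s * r * (x s + r))).
- field; repeat split; lra.
- rewrite hrr; field; repeat split; lra.
Qed.

Lemma is_derive_lagrangian (lam : R) (x y p q : R -> R) (dx dy dp dq s : R) :
  0 < x s -> 0 < y s -> 0 < p s ^ 2 + q s ^ 2 ->
  is_derive x s dx -> is_derive y s dy -> is_derive p s dp -> is_derive q s dq ->
  is_derive (fun t => lagrangian lam (x t) (y t) (p t) (q t)) s
    (lagrangian_x (x s) (y s) (p s) (q s) * dx
     + lagrangian_y lam (x s) (y s) (p s) (q s) * dy
     + lagrangian_p lam (x s) (y s) (p s) (q s) * dp
     + lagrangian_q lam (x s) (y s) (p s) (q s) * dq).
Proof.
intros hx hy hm hdx hdy hdp hdq.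
assert (hr0 : 0 < x s ^ 2 + y s ^ 2) by nra.
destruct (sqrt_sum_sqr_pos _ _ hr0) as [hr _].
destruct (sqrt_sum_sqr_pos _ _ hm) as [hn _].
assert (hd := is_derive_hyp_dist_L x y dx dy s hx hy hdx hdy).
assert (hs := is_derive_sqrt_sum_sqr p q dp dq s hm hdp hdq).
assert (hq := is_derive_div _ y s _ _ hs hdy (Rgt_not_eq _ _ hy)).
assert (hl := is_derive_plus _ _ s _ _ hd (is_derive_const lam s)).
apply (is_derive_eq _ _ _ _ (Derive.is_derive_mult _ _ s _ _ hl hq)).
unfold plus, zero; cbn -[pow sqrt].
unfold lagrangian_x, lagrangian_y, lagrangian_p, lagrangian_q.
field; repeat split; lra.
Qed.

(** Not divided by [d + lam], which is known to be nonzero only on [[a, b]]: in this form it is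
    smooth on an open neighbourhood too. *)
Definition catenary_defect (lam : R) (u v : R -> R) (t : R) : R :=
  (hyp_dist_L (u t, v t) + lam) * geodesic_curvature u v t
  - hyp_metric (u t, v t) (unit_normal u v t) (field_Y (u t, v t)).

(** The product and quotient rules give [(F_p)']; comparison with the curvature formula then yields
    [F_x - (F_p)' = v' W / v^2]. *)
Lemma euler_lagrange_x (lam : R) (u v : R -> R) (t : R) :
  0 < u t -> 0 < v t -> 0 < speed2 u v t -> ex_derive u t -> ex_derive v t ->
  ex_derive (Derive u) t -> ex_derive (Derive v) t ->
  is_derive (fun t => lagrangian_p lam (u t) (v t) (Derive u t) (Derive v t)) t
    (lagrangian_x (u t) (v t) (Derive u t) (Derive v t)
     - Derive v t * catenary_defect lam u v t / v t ^ 2).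
Proof.
intros hu hv hm hdu hdv hddu hddv.
apply Derive_correct in hdu, hdv, hddu, hddv.
unfold catenary_defect; rewrite geodesic_curvatureE; auto.
change (Derive_n u 2 t) with (Derive (Derive u) t).
change (Derive_n v 2 t) with (Derive (Derive v) t).
unfold speed2 in *.
assert (hr0 : 0 < u t ^ 2 + v t ^ 2) by nra.
destruct (sqrt_sum_sqr_pos _ _ hr0) as [hr _].
destruct (sqrt_sum_sqr_pos _ _ hm) as [hn hnn].
assert (hd := is_derive_hyp_dist_L u v _ _ t hu hv hdu hdv).
assert (hl := is_derive_plus _ _ t _ _ hd (is_derive_const lam t)).
assert (hl' := is_derive_div _ v t _ _ hl hdv (Rgt_not_eq _ _ hv)).
assert (hs := is_derive_sqrt_sum_sqr _ _ _ _ t hm hddu hddv).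
assert (hq := is_derive_div _ _ t _ _ hddu hs (Rgt_not_eq _ _ hn)).
apply (is_derive_eq _ _ _ _ (Derive.is_derive_mult _ _ t _ _ hl' hq)).
unfold plus, zero, unit_normal, field_Y, hyp_metric, lagrangian_x, speed2;
  cbn -[pow sqrt Derive].
clear - hv hr hn hnn; revert hr hn hnn.
generalize (sqrt (u t ^ 2 + v t ^ 2)).
generalize (sqrt (Derive u t ^ 2 + Derive v t ^ 2)); intros n r hr hn hnn.
(* The two sides agree only modulo [n^2 = u'^2 + v'^2], so their difference is factored through that
   relation. *)
apply Rminus_diag_uniq.
transitivity ((Derive u t ^ 2 + Derive v t ^ 2 - n ^ 2)
  * (1 / (r * v t * n)
     - (hyp_dist_L (u t, v t) + lam) * Derive (Derive u) t / (v t * n ^ 3))).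
- field; repeat split; lra.
- rewrite hnn; ring.
Qed.

(** The companion of [euler_lagrange_x], with the opposite sign: the homogeneity of [F] forces [u']
    and [v'] times the two Euler-Lagrange expressions to add up to zero. *)
Lemma euler_lagrange_y (lam : R) (u v : R -> R) (t : R) :
  0 < u t -> 0 < v t -> 0 < speed2 u v t -> ex_derive u t -> ex_derive v t ->
  ex_derive (Derive u) t -> ex_derive (Derive v) t ->
  is_derive (fun t => lagrangian_q lam (u t) (v t) (Derive u t) (Derive v t)) t
    (lagrangian_y lam (u t) (v t) (Derive u t) (Derive v t)
     + Derive u t * catenary_defect lam u v t / v t ^ 2).
Proof.
intros hu hv hm hdu hdv hddu hddv.
apply Derive_correct in hdu, hdv, hddu, hddv.
unfold catenary_defect; rewrite geodesic_curvatureE; auto.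
change (Derive_n u 2 t) with (Derive (Derive u) t).
change (Derive_n v 2 t) with (Derive (Derive v) t).
unfold speed2 in *.
assert (hr0 : 0 < u t ^ 2 + v t ^ 2) by nra.
destruct (sqrt_sum_sqr_pos _ _ hr0) as [hr _].
destruct (sqrt_sum_sqr_pos _ _ hm) as [hn hnn].
assert (hd := is_derive_hyp_dist_L u v _ _ t hu hv hdu hdv).
assert (hl := is_derive_plus _ _ t _ _ hd (is_derive_const lam t)).
assert (hl' := is_derive_div _ v t _ _ hl hdv (Rgt_not_eq _ _ hv)).
assert (hs := is_derive_sqrt_sum_sqr _ _ _ _ t hm hddu hddv).
assert (hq := is_derive_div _ _ t _ _ hddv hs (Rgt_not_eq _ _ hn)).
apply (is_derive_eq _ _ _ _ (Derive.is_derive_mult _ _ t _ _ hl' hq)).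
unfold plus, zero, unit_normal, field_Y, hyp_metric, lagrangian_y, speed2;
  cbn -[pow sqrt Derive].
clear - hv hr hn hnn; revert hr hn hnn.
generalize (sqrt (u t ^ 2 + v t ^ 2)).
generalize (sqrt (Derive u t ^ 2 + Derive v t ^ 2)); intros n r hr hn hnn.
apply Rminus_diag_uniq.
transitivity ((Derive u t ^ 2 + Derive v t ^ 2 - n ^ 2)
  * (- u t / (r * v t ^ 2 * n) - (hyp_dist_L (u t, v t) + lam) / (v t ^ 2 * n)
     - (hyp_dist_L (u t, v t) + lam) * Derive (Derive v) t / (v t * n ^ 3))).
- field; repeat split; lra.
- rewrite hnn; ring.
Qed.

(** * Continuity and positivity near a segment *)

Lemma continuity_2d_pt_sqrt (f : R -> R -> R) (s t : R) :
  0 < f s t -> continuity_2d_pt f s t ->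
  continuity_2d_pt (fun x y => sqrt (f x y)) s t.
Proof.
intros h; apply continuity_1d_2d_pt_comp, continuity_pt_sqrt; lra.
Qed.

Lemma continuity_2d_pt_ln (f : R -> R -> R) (s t : R) :
  0 < f s t -> continuity_2d_pt f s t ->
  continuity_2d_pt (fun x y => ln (f x y)) s t.
Proof.
intros h; apply continuity_1d_2d_pt_comp, continuity_pt_filterlim.
apply continuous_ln; exact h.
Qed.

Lemma continuity_2d_pt_div (f g : R -> R -> R) (s t : R) :
  g s t <> 0 -> continuity_2d_pt f s t -> continuity_2d_pt g s t ->
  continuity_2d_pt (fun x y => f x y / g x y) s t.
Proof.
intros hg hf hg'; apply continuity_2d_pt_mult; auto.
apply continuity_2d_pt_inv; auto.
Qed.

Lemma continuity_2d_pt_sqr (f : R -> R -> R) (s t : R) :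
  continuity_2d_pt f s t -> continuity_2d_pt (fun x y => f x y ^ 2) s t.
Proof.
intros hf; cbn [pow]; repeat apply continuity_2d_pt_mult; auto.
apply continuity_2d_pt_const.
Qed.

Lemma continuity_2d_pt_pos (f : R -> R -> R) (s t : R) :
  continuity_2d_pt f s t -> 0 < f s t -> locally_2d (fun x y => 0 < f x y) s t.
Proof.
intros hf h; apply locally_2d_impl with (2 := hf (mkposreal _ h)).
apply locally_2d_forall; intros x y; cbn [pos].
intros hxy; apply Rabs_def2 in hxy; lra.
Qed.

Lemma continuity_2d_pt_continuous (f : R -> R -> R) (s t : R) :
  continuity_2d_pt f s t -> continuous (f s) t.
Proof.
intros hf; apply continuity_pt_filterlim.
apply continuity_pt_locally; intros eps.
exact (locally_2d_1d_const_x _ _ _ (hf eps)).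
Qed.

(** By compactness: [f 0] has a positive minimum on [[a, b]], and uniform continuity near the
    segment keeps [f s] within that minimum of [f 0] for all small [s]. *)
Lemma pos_near_segment (f : R -> R -> R) (a b : R) :
  a <= b -> (forall t, a <= t <= b -> continuity_2d_pt f 0 t) ->
  (forall t, a <= t <= b -> 0 < f 0 t) ->
  exists d, 0 < d /\ forall s t, Rabs s < d -> a <= t <= b -> 0 < f s t.
Proof.
intros hab hf hpos.
destruct (continuity_ab_min (f 0) a b hab) as [m [hm hmab]].
{ intros t ht; apply continuity_pt_filterlim.
  apply continuity_2d_pt_continuous; auto. }
destruct (uniform_continuity_2d_1d' f a b 0 hf (mkposreal _ (hpos m hmab)))
  as [d hd].
exists d; split; [apply cond_pos|].
intros s t hs ht.
assert (h0 := cond_pos d).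
assert (h := hd t 0 t s ht); cbn [pos] in h; apply Rabs_def2 in hs.
replace (t - t) with 0 in h by ring; rewrite Rabs_R0 in h.
assert (h' : Rabs (f s t - f 0 t) < f 0 m) by (apply h; auto; lra).
apply Rabs_def2 in h'; generalize (hm t ht); lra.
Qed.

Lemma locally_pos (f : R -> R) (t : R) :
  continuous f t -> 0 < f t ->
  exists d : R, 0 < d /\ forall x, Rabs (x - t) < d -> 0 < f x.
Proof.
intros hf h.
destruct (hf (fun y => 0 < y) (open_gt 0 _ h)) as [d hd].
exists d; split; [apply cond_pos | exact hd].
Qed.

Lemma pos_beyond_segment (f : R -> R) (a b : R) :
  continuous f a -> continuous f b -> a <= b ->
  (forall t, a <= t <= b -> 0 < f t) ->
  exists d, 0 < d /\ forall t, a - d < t < b + d -> 0 < f t.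
Proof.
intros ha hb hab hf.
destruct (locally_pos f a ha (hf a ltac:(lra))) as [d1 [hd1 h1]].
destruct (locally_pos f b hb (hf b ltac:(lra))) as [d2 [hd2 h2]].
exists (Rmin d1 d2); split; [apply Rmin_glb_lt; auto|].
intros t ht; generalize (Rmin_l d1 d2) (Rmin_r d1 d2); intros hl hr.
destruct (Rlt_dec t a); [apply h1, Rabs_def1; lra|].
destruct (Rlt_dec b t); [apply h2, Rabs_def1; lra|].
apply hf; lra.
Qed.

(** Carries identities to the endpoints, where two-sided derivatives of functions that agree only on
    [[a, b]] cannot be compared directly. *)
Lemma continuous_eq_on_segment (f g : R -> R) (a b t : R) :
  a < b -> a <= t <= b -> continuous f t -> continuous g t ->
  (forall x, a < x < b -> f x = g x) -> f t = g t.
Proof.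
intros hab ht hf hg hfg.
(* Squaring makes a nonzero difference positive, so that it stays positive near [t]. *)
assert (hc : continuous (fun x => (f x - g x) ^ 2) t).
{ apply (continuous_comp (fun x => f x - g x) (fun y => y ^ 2)).
  - apply (continuous_minus f g); auto.
  - apply (ex_derive_continuous (fun y => y ^ 2)); auto_derive; auto. }
destruct (Req_dec (f t) (g t)) as [|hne]; [auto|exfalso].
destruct (locally_pos _ t hc) as [d [hd h]]; [apply pow2_gt_0; lra|].
assert (hx : exists x, a < x < b /\ Rabs (x - t) < d).
{ generalize (Rmin_l d (b - a)) (Rmin_r d (b - a)); intros hl hr.
  assert (h0 : 0 < Rmin d (b - a)) by (apply Rmin_glb_lt; lra).
  (* Moving from [t] towards the farther endpoint by a quarter of [Rmin d (b - a)] stays inside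
     [(a, b)]. *)
  destruct (Rlt_dec t ((a + b) / 2)).
  - exists (t + Rmin d (b - a) / 4); split; [|apply Rabs_def1]; lra.
  - exists (t - Rmin d (b - a) / 4); split; [|apply Rabs_def1]; lra. }
destruct hx as [x [hx hxt]].
generalize (h x hxt); rewrite (hfg x hx); lra.
Qed.

Lemma open_interval (c d : R) : open (fun t => c < t < d).
Proof. apply open_and; [apply open_gt | apply open_lt]. Qed.

(** * Joint continuity of the integrand and of its parameter derivative *)

Ltac continuity_2d :=
  repeat first
    [ assumption | apply continuity_2d_pt_const
    | apply continuity_2d_pt_plus | apply continuity_2d_pt_opp
    | apply continuity_2d_pt_div | apply continuity_2d_pt_mult
    | apply continuity_2d_pt_sqr | apply continuity_2d_pt_sqrt
    | apply continuity_2d_pt_ln ].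

(** The differential of the integrand applied to [(dx, dy, dp, dq)]: the chain-rule value found in
    [is_derive_lagrangian]. *)
Definition lagrangian_diff (lam x y p q dx dy dp dq : R) : R :=
  lagrangian_x x y p q * dx + lagrangian_y lam x y p q * dy
  + lagrangian_p lam x y p q * dp + lagrangian_q lam x y p q * dq.

Lemma continuity_2d_pt_lagrangian (lam : R) (x y p q : R -> R -> R) (s t : R) :
  0 < x s t -> 0 < y s t -> 0 < p s t ^ 2 + q s t ^ 2 ->
  continuity_2d_pt x s t -> continuity_2d_pt y s t ->
  continuity_2d_pt p s t -> continuity_2d_pt q s t ->
  continuity_2d_pt (fun s t => lagrangian lam (x s t) (y s t) (p s t) (q s t)) s t.
Proof.
intros hx hy hm; intros.
assert (hr0 : 0 < x s t ^ 2 + y s t ^ 2) by nra.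
destruct (sqrt_sum_sqr_pos _ _ hr0) as [hr _].
unfold lagrangian, hyp_dist_L; cbn [fst snd].
continuity_2d; auto; try lra.
apply Rdiv_lt_0_compat; lra.
Qed.

Lemma continuity_2d_pt_lagrangian_diff
  (lam : R) (x y p q dx dy dp dq : R -> R -> R) (s t : R) :
  0 < x s t -> 0 < y s t -> 0 < p s t ^ 2 + q s t ^ 2 ->
  continuity_2d_pt x s t -> continuity_2d_pt y s t ->
  continuity_2d_pt p s t -> continuity_2d_pt q s t ->
  continuity_2d_pt dx s t -> continuity_2d_pt dy s t ->
  continuity_2d_pt dp s t -> continuity_2d_pt dq s t ->
  continuity_2d_pt (fun s t => lagrangian_diff lam (x s t) (y s t) (p s t) (q s t)
    (dx s t) (dy s t) (dp s t) (dq s t)) s t.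
Proof.
intros hx hy hm; intros.
assert (hr0 : 0 < x s t ^ 2 + y s t ^ 2) by nra.
destruct (sqrt_sum_sqr_pos _ _ hr0) as [hr _].
destruct (sqrt_sum_sqr_pos _ _ hm) as [hn _].
assert (hyr := Rmult_lt_0_compat _ _ hy hr).
assert (hyy := pow_lt _ 2 hy).
assert (hd : 0 < (x s t + sqrt (x s t ^ 2 + y s t ^ 2)) / y s t)
  by (apply Rdiv_lt_0_compat; lra).
unfold lagrangian_diff, lagrangian_x, lagrangian_y, lagrangian_p, lagrangian_q,
  hyp_dist_L; cbn [fst snd].
continuity_2d; lra.
Qed.

(** Collects what differentiation under the integral and integration by parts need. The Schwarz
    identity says that the parameter derivative of the velocity is the [t]-derivative of the
    variation field. *)
Lemma variation_regularity (U : R -> R -> R) (e c d : R) :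
  (forall n s t, - e < s < e -> c < t < d -> ex_diff_n U n s t) ->
  let Us := fun s t => Derive (fun z => U z t) s in
  let Ut := fun s t => Derive (U s) t in
  let Uts := fun s t => Derive (fun z => Ut z t) s in
  forall s t, - e < s < e -> c < t < d ->
  is_derive (fun z => U z t) s (Us s t) /\
  is_derive (fun z => Ut z t) s (Uts s t) /\
  Uts s t = Derive (Us s) t /\
  continuity_2d_pt U s t /\ continuity_2d_pt Ut s t /\
  continuity_2d_pt Us s t /\ continuity_2d_pt Uts s t /\
  ex_derive (Us s) t /\ continuous (Derive (Us s)) t.
Proof.
intros h Us Ut Uts s t hs ht.
destruct (h 2%nat s t hs ht) as
  [c0 [d1 [_ [[cs [_ [ds [_ [cts' _]]]]] [ct [dt [_ [[cts _] _]]]]]]]].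
(* The Schwarz theorem asks for differentiability on a whole neighbourhood, supplied by the open
   rectangle. *)
assert (hrect : locally_2d (fun x y => (- e < x < e) /\ (c < y < d)) s t).
{ apply locally_2d_and.
  - destruct (open_interval _ _ s hs) as [r hr].
    exists r; intros x y hx _; apply hr; exact hx.
  - destruct (open_interval _ _ t ht) as [r hr].
    exists r; intros x y _ hy; apply hr; exact hy. }
assert (hsch : Uts s t = Derive (Us s) t).
{ apply Schwarz; [|exact cts | exact cts'].
  apply locally_2d_impl with (2 := hrect); apply locally_2d_forall.
  intros x y [hx hy].
  destruct (h 2%nat x y hx hy) as [_ [e1 [e2 [[_ [_ [e3 _]]] [_ [e4 _]]]]]].
  auto. }
split; [exact (Derive_correct _ _ d1)|].
split; [exact (Derive_correct _ _ dt)|].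
repeat (split; [assumption|]).
exact (continuity_2d_pt_continuous _ _ _ cts').
Qed.

(** * Smooth immersed curves in the half-plane *)

(** Stated on an open set so that, on an interval slightly larger than [[a, b]], the endpoints
    become interior points. *)
Definition smooth_immersion_on (D : R -> Prop) (u v : R -> R) : Prop :=
  open D /\ (forall n, Ck_on D n u /\ Ck_on D n v) /\
  forall t, D t -> 0 < u t /\ 0 < v t /\ 0 < speed2 u v t.

Lemma smooth_immersion_Derive (D : R -> Prop) (u v : R -> R) (n : nat) :
  smooth_immersion_on D u v -> Ck_on D n (Derive u) /\ Ck_on D n (Derive v).
Proof.
intros [_ [h _]]; destruct (h (S n)) as [[_ hu] [_ hv]]; auto.
Qed.

(** The quotient rule stands before the product rule, as in [continuity_2d]: [Rdiv] unfolds to a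
    product with an inverse, for which no rule is listed. *)
Ltac Ck :=
  repeat first
    [ assumption | apply Ck_on_const | apply Ck_on_plus | apply Ck_on_minus
    | apply Ck_on_opp | apply Ck_on_div | apply Ck_on_mult | apply Ck_on_pow
    | apply Ck_on_sqrt | apply Ck_on_ln ].

Lemma Ck_on_hyp_dist_L (D : R -> Prop) (u v : R -> R) (n : nat) :
  smooth_immersion_on D u v -> Ck_on D n (fun t => hyp_dist_L (u t, v t)).
Proof.
intros [hD [h hpos]]; destruct (h n) as [hu hv].
assert (hr0 : forall t, D t -> 0 < u t ^ 2 + v t ^ 2)
  by (intros t ht; generalize (hpos t ht); nra).
unfold hyp_dist_L; cbn [fst snd]; Ck; intros t ht.
- apply Rdiv_lt_0_compat; [|apply hpos; auto].
  generalize (hpos t ht) (sqrt_lt_R0 _ (hr0 t ht)); lra.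
- auto.
- generalize (hpos t ht); lra.
Qed.

(** This smoothness makes the test direction built from [W] an admissible variation. *)
Lemma Ck_on_catenary_defect (lam : R) (D : R -> Prop) (u v : R -> R) (n : nat) :
  smooth_immersion_on D u v -> Ck_on D n (catenary_defect lam u v).
Proof.
intros huv.
assert (hd := Ck_on_hyp_dist_L _ _ _ n huv).
destruct (smooth_immersion_Derive _ _ _ n huv) as [hdu hdv].
assert (hddu := proj2 (proj1 (smooth_immersion_Derive _ _ _ (S n) huv))).
assert (hddv := proj2 (proj2 (smooth_immersion_Derive _ _ _ (S n) huv))).
change (Derive (Derive u)) with (Derive_n u 2) in hddu.
change (Derive (Derive v)) with (Derive_n v 2) in hddv.
destruct huv as [hD [h hpos]]; destruct (h n) as [hu hv].
apply Ck_on_ext with (fun t => (hyp_dist_L (u t, v t) + lam) *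
  (v t * ((Derive u t * Derive_n v 2 t - Derive_n u 2 t * Derive v t)
           / (sqrt (speed2 u v t)) ^ 3)
    + Derive u t / sqrt (speed2 u v t))
  - hyp_metric (u t, v t) (unit_normal u v t) (field_Y (u t, v t))); auto.
{ intros t ht; unfold catenary_defect.
  rewrite geodesic_curvatureE; auto; apply hpos; auto. }
unfold hyp_metric, unit_normal, field_Y, speed2; cbn [fst snd].
assert (hn : forall t, D t -> 0 < sqrt (Derive u t ^ 2 + Derive v t ^ 2))
  by (intros t ht; apply sqrt_lt_R0, hpos, ht).
assert (hr0 : forall t, D t -> 0 < u t ^ 2 + v t ^ 2)
  by (intros t ht; generalize (hpos t ht); nra).
Ck; intros t ht; try apply pow_nonzero;
  try (generalize (hn t ht) (sqrt_lt_R0 _ (hr0 t ht)) (hpos t ht); lra);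
  try apply hpos; auto.
Qed.

Lemma Ck_on_lagrangian_pq (lam : R) (D : R -> Prop) (u v : R -> R) (n : nat) :
  smooth_immersion_on D u v ->
  Ck_on D n (fun t => lagrangian_p lam (u t) (v t) (Derive u t) (Derive v t)) /\
  Ck_on D n (fun t => lagrangian_q lam (u t) (v t) (Derive u t) (Derive v t)).
Proof.
intros huv.
assert (hd := Ck_on_hyp_dist_L _ _ _ n huv).
destruct (smooth_immersion_Derive _ _ _ n huv) as [hdu hdv].
destruct huv as [hD [h hpos]]; destruct (h n) as [hu hv].
unfold lagrangian_p, lagrangian_q.
assert (hn : forall t, D t -> 0 < sqrt (Derive u t ^ 2 + Derive v t ^ 2))
  by (intros t ht; apply sqrt_lt_R0, hpos, ht).
split; Ck; intros t ht;
  try (generalize (hn t ht) (hpos t ht); lra); apply hpos; auto.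
Qed.

(** Positivity of [u], [v] and the squared speed persists slightly beyond the segment by continuity.
    The bound [e] lets the enlarged interval fit inside the domain of a given variation. *)
Lemma smooth_immersion_beyond_segment (a b e : R) (u v : R -> R) :
  a <= b -> 0 < e -> smooth_on_segment a b u -> smooth_on_segment a b v ->
  (forall t, a <= t <= b -> in_H2plus (u t, v t)) ->
  regular_on_segment a b u v ->
  exists d, 0 < d /\ d <= e /\
    smooth_immersion_on (fun t => a - d < t < b + d) u v.
Proof.
intros hab he [e1 [he1 hu]] [e2 [he2 hv]] hH hreg.
assert (hu' := Ck_on_Derive_n (fun t => a - e1 < t < b + e1) u hu).
assert (hv' := Ck_on_Derive_n (fun t => a - e2 < t < b + e2) v hv).
assert (hcu : forall k t, a <= t <= b -> continuous (Derive_n u k) t)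
  by (intros k t ht; apply (Ck_on_continuous _ 0 _ t (hu' 0%nat k)); lra).
assert (hcv : forall k t, a <= t <= b -> continuous (Derive_n v k) t)
  by (intros k t ht; apply (Ck_on_continuous _ 0 _ t (hv' 0%nat k)); lra).
assert (hcm : forall t, a <= t <= b -> continuous (speed2 u v) t).
{ intros t ht; unfold speed2.
  apply (continuous_plus (fun t => Derive u t ^ 2) (fun t => Derive v t ^ 2)).
  - apply (continuous_comp (Derive u) (fun y => y ^ 2)); [exact (hcu 1%nat t ht)|].
    apply (ex_derive_continuous (fun y => y ^ 2)); auto_derive; auto.
  - apply (continuous_comp (Derive v) (fun y => y ^ 2)); [exact (hcv 1%nat t ht)|].
    apply (ex_derive_continuous (fun y => y ^ 2)); auto_derive; auto. }
assert (hm : forall t, a <= t <= b -> 0 < speed2 u v t).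
{ intros t ht; generalize (hreg t ht); unfold speed2; intros hne.
  destruct (Req_dec (Derive u t) 0) as [h0|h0].
  - assert (h1 : Derive v t <> 0) by auto.
    apply pow2_gt_0 in h1; nra.
  - apply pow2_gt_0 in h0; nra. }
destruct (pos_beyond_segment u a b) as [d1 [hd1 h1]]; auto;
  try (apply (hcu 0%nat); lra); [apply hH|].
destruct (pos_beyond_segment v a b) as [d2 [hd2 h2]]; auto;
  try (apply (hcv 0%nat); lra); [apply hH|].
destruct (pos_beyond_segment (speed2 u v) a b) as [d3 [hd3 h3]]; auto;
  try (apply hcm; lra).
set (d := Rmin (Rmin e (Rmin e1 e2)) (Rmin d1 (Rmin d2 d3))).
assert (hd : 0 < d) by (repeat apply Rmin_glb_lt; auto).
assert (hde : d <= Rmin e (Rmin e1 e2)) by apply Rmin_l.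
assert (hdd : d <= Rmin d1 (Rmin d2 d3)) by apply Rmin_r.
generalize (Rmin_l e (Rmin e1 e2)) (Rmin_r e (Rmin e1 e2))
  (Rmin_l e1 e2) (Rmin_r e1 e2) (Rmin_l d1 (Rmin d2 d3))
  (Rmin_r d1 (Rmin d2 d3)) (Rmin_l d2 d3) (Rmin_r d2 d3); intros.
exists d; split; [exact hd|split; [lra|split; [|split]]].
- apply open_interval.
- intros n; split.
  + eapply Ck_on_subset; [|exact (hu' n 0%nat)]; cbn; intros; lra.
  + eapply Ck_on_subset; [|exact (hv' n 0%nat)]; cbn; intros; lra.
- intros t ht; split; [apply h1|split; [apply h2|apply h3]]; lra.
Qed.

(** * The first variation *)

(** The integrand of the first variation in the direction [(xi, eta)]. The factor [v' xi - u' eta]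
    kills tangential directions. *)
Definition variation_pairing (lam : R) (u v xi eta : R -> R) (t : R) : R :=
  (Derive v t * xi t - Derive u t * eta t) * (catenary_defect lam u v t / v t ^ 2).

Lemma Ck_on_variation_pairing
  (lam : R) (D : R -> Prop) (u v xi eta : R -> R) (n : nat) :
  smooth_immersion_on D u v -> Ck_on D n xi -> Ck_on D n eta ->
  Ck_on D n (variation_pairing lam u v xi eta).
Proof.
intros huv hxi heta.
assert (hw := Ck_on_catenary_defect lam D u v n huv).
destruct (smooth_immersion_Derive _ _ _ n huv) as [hdu hdv].
destruct huv as [hD [h hpos]]; destruct (h n) as [hu hv].
unfold variation_pairing; Ck.
intros t ht; apply pow_nonzero; generalize (hpos t ht); lra.
Qed.

(* The boundary term [F_p xi + F_q eta] of the integration by parts vanishes since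
   the variation fixes the endpoints. *)
Lemma RInt_lagrangian_diff
  (lam a b d : R) (u v xi eta : R -> R) :
  a < b -> 0 < d -> smooth_immersion_on (fun t => a - d < t < b + d) u v ->
  Ck_on (fun t => a - d < t < b + d) 1 xi ->
  Ck_on (fun t => a - d < t < b + d) 1 eta ->
  xi a = 0 -> eta a = 0 -> xi b = 0 -> eta b = 0 ->
  RInt (fun t => lagrangian_diff lam (u t) (v t) (Derive u t) (Derive v t)
    (xi t) (eta t) (Derive xi t) (Derive eta t)) a b
  = RInt (variation_pairing lam u v xi eta) a b.
Proof.
intros hab hd huv hxi heta hxa hea hxb heb.
set (G := fun t => lagrangian_p lam (u t) (v t) (Derive u t) (Derive v t) * xi t
  + lagrangian_q lam (u t) (v t) (Derive u t) (Derive v t) * eta t).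
destruct (Ck_on_lagrangian_pq lam _ u v 1 huv) as [hp hq].
assert (hA := Ck_on_variation_pairing lam _ u v xi eta 1 huv hxi heta).
assert (hG : Ck_on (fun t => a - d < t < b + d) 1 G)
  by (apply Ck_on_plus; [apply open_interval | apply Ck_on_mult ..]; auto;
      apply open_interval).
(* The fundamental theorem of calculus, with [G] zero at both endpoints. *)
assert (hIG : is_RInt (Derive G) a b 0).
{ replace 0 with (minus (G b) (G a))
    by (unfold minus, plus, opp, G; simpl; rewrite hxa, hea, hxb, heb; ring).
  apply (is_RInt_derive G (Derive G)); intros t;
    rewrite Rmin_left, Rmax_right by lra; intros ht.
  - apply Derive_correct, hG; lra.
  - apply (Ck_on_continuous _ 0 _ _ (proj2 hG)); lra. }
assert (hIA : ex_RInt (variation_pairing lam u v xi eta) a b).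
{ apply (ex_RInt_continuous (variation_pairing lam u v xi eta)); intros t.
  rewrite Rmin_left, Rmax_right by lra; intros ht.
  apply (Ck_on_continuous _ _ _ _ hA); lra. }
assert (hsum : is_RInt (fun t => variation_pairing lam u v xi eta t + Derive G t) a b
  (RInt (variation_pairing lam u v xi eta) a b + 0))
  by exact (is_RInt_plus _ _ _ _ _ _ (RInt_correct _ _ _ hIA) hIG).
rewrite Rplus_0_r in hsum.
rewrite <- (is_RInt_unique _ _ _ _ hsum).
apply RInt_ext; intros t; rewrite Rmin_left, Rmax_right by lra; intros ht.
assert (hI : a - d < t < b + d) by lra.
assert (hdd := smooth_immersion_Derive _ _ _ 1 huv).
destruct huv as [hD [h hpos]]; destruct (h 1%nat) as [hu hv].
destruct (hpos t hI) as [hu0 [hv0 hm0]].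
assert (hEx := euler_lagrange_x lam u v t hu0 hv0 hm0 (proj1 hu t hI)
  (proj1 hv t hI) (proj1 (proj1 hdd) t hI) (proj1 (proj2 hdd) t hI)).
assert (hEy := euler_lagrange_y lam u v t hu0 hv0 hm0 (proj1 hu t hI)
  (proj1 hv t hI) (proj1 (proj1 hdd) t hI) (proj1 (proj2 hdd) t hI)).
(* With the Euler-Lagrange identities inserted, the product rule gives [G'] as the differential of
   the integrand minus the pairing. *)
assert (hdG : is_derive G t _)
  by exact (is_derive_plus _ _ t _ _
      (Derive.is_derive_mult _ _ t _ _ hEx (Derive_correct _ _ (proj1 hxi t hI)))
      (Derive.is_derive_mult _ _ t _ _ hEy (Derive_correct _ _ (proj1 heta t hI)))).
rewrite (is_derive_unique _ _ _ hdG).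
unfold plus; cbn -[pow Derive].
unfold variation_pairing, lagrangian_diff; field; lra.
Qed.

(** Differentiation under the integral sign at parameter 0, followed by [RInt_lagrangian_diff]
    applied to the variation field. *)
Lemma first_variation (lam a b : R) (u v : R -> R) (U V : R -> R -> R) :
  a < b -> smooth_on_segment a b u -> smooth_on_segment a b v ->
  (forall t, a <= t <= b -> in_H2plus (u t, v t)) ->
  regular_on_segment a b u v -> smooth_variation a b u v U V ->
  is_derive (fun s => potential_energy lam a b (U s) (V s)) 0
    (RInt (variation_pairing lam u v
       (fun t => Derive (fun z => U z t) 0) (fun t => Derive (fun z => V z t) 0)) a b).
Proof.
intros hab hu hv hH hreg [e [he [hUV [hpos [h0 hends]]]]].
destruct (smooth_immersion_beyond_segment a b e u v) as [d [hd [hde huv]]]; auto;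
  try lra.
assert (hUreg := variation_regularity U e (a - e) (b + e)
  (fun n s t hs ht => proj1 (hUV n s t hs ht))).
assert (hVreg := variation_regularity V e (a - e) (b + e)
  (fun n s t hs ht => proj2 (hUV n s t hs ht))).
cbv zeta in hUreg, hVreg.
set (Us := fun s t => Derive (fun z => U z t) s) in *.
set (Vs := fun s t => Derive (fun z => V z t) s) in *.
set (Ut := fun s t => Derive (U s) t) in *.
set (Vt := fun s t => Derive (V s) t) in *.
set (Uts := fun s t => Derive (fun z => Ut z t) s) in *.
set (Vts := fun s t => Derive (fun z => Vt z t) s) in *.
assert (hin : forall s t, Rabs s < e -> a <= t <= b ->
  - e < s < e /\ a - e < t < b + e)
  by (intros s t hs ht; apply Rabs_def2 in hs; lra).
assert (he0 : Rabs 0 < e) by (rewrite Rabs_R0; exact he).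
(* [U 0] and [u] agree only on [[a, b]]: their derivatives are compared inside and then, by
   continuity, at the endpoints. *)
assert (hUt0 : forall t, a <= t <= b -> Ut 0 t = Derive u t /\ Vt 0 t = Derive v t).
{ intros t ht; destruct (hin 0 t he0 ht) as [hs' ht'].
  destruct (smooth_immersion_Derive _ _ _ 0 huv) as [hdu hdv].
  destruct (hUreg 0 t hs' ht') as
    [dU [dUt [eU [cU [cUt [cUs [cUts _]]]]]]].
  destruct (hVreg 0 t hs' ht') as
    [dV [dVt [eV [cV [cVt [cVs [cVts _]]]]]]].
  split; [apply (continuous_eq_on_segment (Ut 0) (Derive u) a b)
         |apply (continuous_eq_on_segment (Vt 0) (Derive v) a b)]; auto;
    try (apply continuity_2d_pt_continuous; assumption);
    try (apply hdu; lra); try (apply hdv; lra);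
    intros x hx; apply Derive_ext_loc;
    apply filter_imp with (2 := open_interval a b x hx);
    intros y hy; apply h0; lra. }
assert (hGc : forall s t, - e < s < e -> a - e < t < b + e ->
  continuity_2d_pt (fun s t => Ut s t ^ 2 + Vt s t ^ 2) s t).
{ intros s t hs ht.
  destruct (hUreg s t hs ht) as [_ [_ [_ [_ [cUt _]]]]].
  destruct (hVreg s t hs ht) as [_ [_ [_ [_ [cVt _]]]]].
  apply continuity_2d_pt_plus; apply continuity_2d_pt_sqr; assumption. }
assert (hG0 : forall t, a <= t <= b -> 0 < Ut 0 t ^ 2 + Vt 0 t ^ 2).
{ intros t ht; destruct (hUt0 t ht) as [-> ->]; apply huv; lra. }
destruct (pos_near_segment (fun s t => Ut s t ^ 2 + Vt s t ^ 2) a b)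
  as [d' [hd' hG]]; [lra | intros t ht; apply hGc; lra | exact hG0 |].
set (f := fun s t => lagrangian lam (U s t) (V s t) (Ut s t) (Vt s t)).
set (f1 := fun s t => lagrangian_diff lam (U s t) (V s t) (Ut s t) (Vt s t)
  (Us s t) (Vs s t) (Uts s t) (Vts s t)).
assert (hf : forall s t, - e < s < e -> a - e < t < b + e ->
  0 < U s t -> 0 < V s t -> 0 < Ut s t ^ 2 + Vt s t ^ 2 ->
  is_derive (fun z => f z t) s (f1 s t)).
{ intros s t hs ht hU0 hV0 hm.
  destruct (hUreg s t hs ht) as [dU [dUt _]].
  destruct (hVreg s t hs ht) as [dV [dVt _]].
  apply (is_derive_lagrangian lam (fun z => U z t) (fun z => V z t)
    (fun z => Ut z t) (fun z => Vt z t)); assumption. }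
assert (hnear : forall P : R -> Prop,
  (forall s, Rabs s < e -> Rabs s < d' -> P s) -> locally 0 P).
{ intros P hP; exists (mkposreal _ (Rmin_glb_lt _ _ _ he hd')).
  intros s hs; assert (hs' : Rabs s < Rmin e d')
    by (replace s with (s - 0) by ring; exact hs).
  generalize (Rmin_l e d') (Rmin_r e d'); intros; apply hP; lra. }
assert (hder : is_derive (fun s => RInt (f s) a b) 0
  (RInt (fun t => Derive (fun z => f z t) 0) a b)).
{ apply (is_derive_RInt_param f); rewrite ?Rmin_left, ?Rmax_right by lra.
  - apply hnear; intros s hs hs' t; intros ht.
    destruct (hin s t hs ht); exists (f1 s t); apply hf; auto;
      apply (hpos s t); auto.
  - intros t ht; destruct (hin 0 t he0 ht) as [hs' ht'].
    destruct (hpos 0 t hs' ht) as [hU0 hV0]; cbn [fst snd] in hU0, hV0.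
    destruct (hUreg 0 t hs' ht') as
      [dU [dUt [eU [cU [cUt [cUs [cUts _]]]]]]].
    destruct (hVreg 0 t hs' ht') as
      [dV [dVt [eV [cV [cVt [cVs [cVts _]]]]]]].
    apply continuity_2d_pt_ext_loc with f1.
    (* [f1] is known to be the parameter derivative only where positions and squared speed are
       positive. This holds on a full neighbourhood of [(0, t)], which may reach beyond [[a, b]]. *)
    + assert (hl := locally_2d_and _ _ _ _
        (continuity_2d_pt_pos _ _ _ cU hU0)
        (locally_2d_and _ _ _ _ (continuity_2d_pt_pos _ _ _ cV hV0)
          (continuity_2d_pt_pos _ _ _ (hGc 0 t hs' ht') (hG0 t ht)))).
      apply (locally_2d_and _ (fun s x => Rabs (s - 0) < e /\ Rabs (x - t) < e))
        in hl; [| exists (mkposreal e he); auto].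
      apply locally_2d_impl with (2 := hl); apply locally_2d_forall.
      intros s x [[hx1 [hx2 hx3]] [hs hx]]; symmetry; apply is_derive_unique.
      apply Rabs_def2 in hs, hx; apply hf; auto; lra.
    + apply continuity_2d_pt_lagrangian_diff; auto.
  - apply hnear; intros s hs hs'; apply (ex_RInt_continuous (f s)).
    intros t; rewrite Rmin_left, Rmax_right by lra; intros ht.
    destruct (hin s t hs ht) as [hs'' ht'].
    destruct (hUreg s t hs'' ht') as [_ [_ [_ [cU [cUt _]]]]].
    destruct (hVreg s t hs'' ht') as [_ [_ [_ [cV [cVt _]]]]].
    destruct (hpos s t hs'' ht) as [hU0 hV0]; cbn [fst snd] in hU0, hV0.
    apply continuity_2d_pt_continuous, continuity_2d_pt_lagrangian; auto. }
(* Fixed endpoints make the variation field vanish there. *)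
assert (hend : forall (W : R -> R -> R) c x,
  (forall s, - e < s < e -> W s x = c) -> Derive (fun z => W z x) 0 = 0).
{ intros W c x hW; transitivity (Derive (fun _ => c) 0); [|apply Derive_const].
  apply Derive_ext_loc.
  apply filter_imp with (2 := open_interval (- e) e 0 ltac:(lra)); auto. }
apply (is_derive_eq _ _ _ _ hder).
rewrite <- (RInt_lagrangian_diff lam a b d); auto.
- apply RInt_ext; intros t; rewrite Rmin_left, Rmax_right by lra; intros ht.
  destruct (hin 0 t he0 ltac:(lra)) as [hs' ht'].
  destruct (hUt0 t ltac:(lra)) as [hUt hVt]; destruct (h0 t ltac:(lra)) as [hU hV].
  rewrite (is_derive_unique _ _ (f1 0 t)).
  + unfold f1; rewrite hU, hV, hUt, hVt.
    (* The rewritten equation is the Schwarz identity. *)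
    destruct (hUreg 0 t hs' ht') as [_ [_ [-> _]]].
    destruct (hVreg 0 t hs' ht') as [_ [_ [-> _]]]; reflexivity.
  + destruct (hpos 0 t hs' ltac:(lra)); apply hf; auto; apply hG0; lra.
- split.
  + intros t ht; apply (hUreg 0 t); lra.
  + intros t ht; apply (hUreg 0 t); lra.
- split.
  + intros t ht; apply (hVreg 0 t); lra.
  + intros t ht; apply (hVreg 0 t); lra.
- apply (hend U (u a)); apply hends.
- apply (hend V (v a)); apply hends.
- apply (hend U (u b)); apply hends.
- apply (hend V (v b)); apply hends.
Qed.

(** * Vanishing integrals and test variations *)

Lemma RInt_nonneg_eq_0 (f : R -> R) (a b : R) :
  a < b -> (forall t, a <= t <= b -> continuous f t) ->
  (forall t, a < t < b -> 0 <= f t) -> RInt f a b = 0 ->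
  forall t, a < t < b -> f t = 0.
Proof.
intros hab hc hf hI t ht.
(* A positive value would give a positive integral over a small interval around [t], while the two
   remaining pieces are nonnegative. *)
destruct (Rle_lt_or_eq_dec 0 (f t) (hf t ht)) as [hpos|]; [exfalso|auto].
destruct (locally_pos f t (hc t ltac:(lra)) hpos) as [d [hd h]].
(* Halving keeps [[t - r, t + r]] strictly inside both [(a, b)] and the neighbourhood where [f] is
   positive. *)
set (r := Rmin d (Rmin (t - a) (b - t)) / 2).
assert (hr0 : 0 < Rmin d (Rmin (t - a) (b - t)))
  by (repeat apply Rmin_glb_lt; lra).
generalize (Rmin_l d (Rmin (t - a) (b - t))) (Rmin_r d (Rmin (t - a) (b - t)))
  (Rmin_l (t - a) (b - t)) (Rmin_r (t - a) (b - t)); intros.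
assert (hr : 0 < r /\ r < d /\ a < t - r /\ t + r < b) by (unfold r; lra).
assert (hint : forall x y, a <= x -> x <= y -> y <= b -> ex_RInt f x y).
{ intros x y hx hxy hy; apply (ex_RInt_continuous f); intros z.
  rewrite Rmin_left, Rmax_right by lra; intros hz; apply hc; lra. }
assert (h1 : 0 <= RInt f a (t - r))
  by (apply RInt_ge_0; [lra | apply hint; lra | intros; apply hf; lra]).
assert (h2 : 0 < RInt f (t - r) (t + r)).
{ apply RInt_gt_0; [lra | intros x hx; apply h, Rabs_def1; lra |].
  intros; apply hc; lra. }
assert (h3 : 0 <= RInt f (t + r) b)
  by (apply RInt_ge_0; [lra | apply hint; lra | intros; apply hf; lra]).
assert (h4 : RInt f a (t - r) + RInt f (t - r) (t + r) = RInt f a (t + r))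
  by (apply (RInt_Chasles f); apply hint; lra).
assert (h5 : RInt f a (t + r) + RInt f (t + r) b = RInt f a b)
  by (apply (RInt_Chasles f); apply hint; lra).
lra.
Qed.

(** Adding a multiple of the direction could leave the quadrant; by compactness of [[a, b]] it does
    not for small parameters. *)
Lemma affine_smooth_variation (a b d : R) (u v xi eta : R -> R) :
  a < b -> 0 < d -> smooth_immersion_on (fun t => a - d < t < b + d) u v ->
  (forall n, Ck_on (fun t => a - d < t < b + d) n xi) ->
  (forall n, Ck_on (fun t => a - d < t < b + d) n eta) ->
  xi a = 0 -> eta a = 0 -> xi b = 0 -> eta b = 0 ->
  smooth_variation a b u v (fun s t => u t + s * xi t) (fun s t => v t + s * eta t).
Proof.
intros hab hd [hD [h hpos]] hxi heta hxa hea hxb heb.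
assert (hdiff : forall n s t, a - d < t < b + d ->
  ex_diff_n (fun s t => u t + s * xi t) n s t /\
  ex_diff_n (fun s t => v t + s * eta t) n s t).
{ intros n s t ht; split;
    apply (ex_diff_n_affine (fun t => a - d < t < b + d)); auto; apply h. }
destruct (pos_near_segment (fun s t => u t + s * xi t) a b) as [d1 [hd1 h1]].
{ lra. }
{ intros t ht; apply (hdiff 0%nat 0 t); lra. }
{ intros t ht; generalize (hpos t ltac:(lra)); lra. }
destruct (pos_near_segment (fun s t => v t + s * eta t) a b) as [d2 [hd2 h2]].
{ lra. }
{ intros t ht; apply (hdiff 0%nat 0 t); lra. }
{ intros t ht; generalize (hpos t ltac:(lra)); lra. }
generalize (Rmin_l d (Rmin d1 d2)) (Rmin_r d (Rmin d1 d2))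
  (Rmin_l d1 d2) (Rmin_r d1 d2); intros.
exists (Rmin d (Rmin d1 d2)); split; [repeat apply Rmin_glb_lt; auto|].
split; [|split; [|split]].
- intros n s t _ ht; apply hdiff; lra.
- intros s t hs ht; split; [apply h1 | apply h2]; auto; apply Rabs_def1; lra.
- intros t _; split; ring.
- intros s _; rewrite hxa, hea, hxb, heb; repeat split; ring.
Qed.

(** * Catenaries and the curvature equation *)

Theorem corollary3p5 (lam a b : R) (u v : R -> R)
  (hab : a < b)
  (hu : smooth_on_segment a b u)
  (hv : smooth_on_segment a b v)
  (hH : forall t : R, a <= t <= b -> in_H2plus (u t, v t))
  (hreg : regular_on_segment a b u v)
  (hd : forall t : R, a <= t <= b -> hyp_dist_L (u t, v t) + lam <> 0) :
  hyperbolic_catenary lam a b u v <->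
  (forall t : R, a <= t <= b ->
     geodesic_curvature u v t =
     hyp_metric (u t, v t) (unit_normal u v t) (field_Y (u t, v t))
     / (hyp_dist_L (u t, v t) + lam)).
Proof.
destruct (smooth_immersion_beyond_segment a b 1 u v) as [d [hd0 [_ huv]]];
  auto; try lra.
(* Since [d + lam] is nonzero on the segment, the curvature equation amounts to [W = 0]. *)
transitivity (forall t, a <= t <= b -> catenary_defect lam u v t = 0).
2:{ unfold catenary_defect; split; intros h t ht; generalize (h t ht) (hd t ht).
    - intros hw hdt; apply (Rmult_eq_reg_l (hyp_dist_L (u t, v t) + lam)); auto.
      field_simplify; lra.
    - intros -> hdt; field; auto. }
split.
- intros hcat.
  set (w := fun t => catenary_defect lam u v t / v t ^ 2).
  (* Positive inside and zero at both ends, so the direction below fixes the endpoints. *)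
  set (bump := fun t => (t - a) * (b - t)).
  set (xi := fun t => Derive v t * (w t * bump t)).
  set (eta := fun t => - Derive u t * (w t * bump t)).
  assert (hD := proj1 huv).
  assert (hv0 : forall t, a - d < t < b + d -> v t <> 0)
    by (intros t ht; generalize (proj2 (proj2 huv) t ht); lra).
  assert (hwb : forall n, Ck_on (fun t => a - d < t < b + d) n
                            (fun t => w t * bump t)).
  { intros n; assert (hw := Ck_on_catenary_defect lam _ u v n huv).
    destruct (proj1 (proj2 huv) n) as [_ hvn].
    unfold w, bump; Ck; try apply Ck_on_id; auto.
    intros t ht; apply pow_nonzero; auto. }
  assert (hxi : forall n, Ck_on (fun t => a - d < t < b + d) n xi).
  { intros n; destruct (smooth_immersion_Derive _ _ _ n huv).
    apply Ck_on_mult; auto. }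
  assert (heta : forall n, Ck_on (fun t => a - d < t < b + d) n eta).
  { intros n; destruct (smooth_immersion_Derive _ _ _ n huv).
    apply Ck_on_mult; auto; apply Ck_on_opp; auto. }
  assert (hvar : smooth_variation a b u v
    (fun s t => u t + s * xi t) (fun s t => v t + s * eta t)).
  { apply (affine_smooth_variation a b d); auto; unfold xi, eta, bump; ring. }
  assert (hI : RInt (variation_pairing lam u v xi eta) a b = 0).
  { assert (h1 := is_derive_unique _ _ _ (hcat _ _ hvar)).
    assert (h2 := is_derive_unique _ _ _
      (first_variation lam a b u v _ _ hab hu hv hH hreg hvar)).
    etransitivity; [|exact (eq_trans (eq_sym h2) h1)].
    apply RInt_ext; intros t _; unfold variation_pairing.
    do 3 f_equal; symmetry; apply is_derive_unique; auto_derive; auto; ring. }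
  assert (hpair : forall t, variation_pairing lam u v xi eta t
                            = speed2 u v t * w t ^ 2 * bump t)
    by (intros t; unfold variation_pairing, xi, eta, speed2, w; ring).
  assert (h0 : forall t, a < t < b -> catenary_defect lam u v t = 0).
  { intros t ht.
    assert (hz := RInt_nonneg_eq_0 (variation_pairing lam u v xi eta) a b hab).
    assert (hz' : variation_pairing lam u v xi eta t = 0).
    { apply hz; auto.
      - intros x hx; apply (Ck_on_continuous (fun t => a - d < t < b + d) 0);
          [apply Ck_on_variation_pairing; auto | lra].
      - intros x hx; rewrite hpair; unfold bump.
        assert (hm := proj2 (proj2 (proj2 (proj2 huv) x ltac:(lra)))).
        apply Rmult_le_pos; [|nra].
        apply Rmult_le_pos; [lra | apply pow2_ge_0]. }
    rewrite hpair in hz'.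
    assert (hm := proj2 (proj2 (proj2 (proj2 huv) t ltac:(lra)))).
    assert (hb : 0 < bump t) by (unfold bump; nra).
    apply Rmult_integral in hz'; destruct hz' as [hz'|]; [|lra].
    apply Rmult_integral in hz'; destruct hz' as [|hz']; [lra|].
    assert (hw : w t = 0) by (destruct (Req_dec (w t) 0) as [|hne];
      [auto | apply (pow_nonzero _ 2) in hne; lra]).
    unfold w in hw; apply Rmult_integral in hw; destruct hw as [|hw]; [auto|].
    exfalso; revert hw; apply Rinv_neq_0_compat, pow_nonzero, hv0; lra. }
  (* The bump vanishes at [a] and [b], so there [W = 0] comes from continuity. *)
  intros t ht.
  apply (continuous_eq_on_segment (catenary_defect lam u v) (fun _ => 0) a b);
    auto; [|apply continuous_const].
  apply (Ck_on_continuous _ 0 _ _ (Ck_on_catenary_defect lam _ u v 0 huv)); lra.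
- intros h0 U V hvar.
  apply (is_derive_eq _ _ _ _ (first_variation lam a b u v U V hab hu hv hH hreg hvar)).
  rewrite (RInt_ext _ (fun _ => 0)).
  + rewrite RInt_const; apply Rmult_0_r.
  + intros t; rewrite Rmin_left, Rmax_right by lra; intros ht.
    unfold variation_pairing; rewrite h0 by lra; unfold Rdiv.
    rewrite Rmult_0_l; apply Rmult_0_r.
Qed.
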